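(* Let $g:\{0,1,\ldots,N\}\to[0,\infty)$ and consider the reward function $$R(\mathcal I,i)=1(i\in\mathcal I)-g(|\mathcal I|),\qquad \mathcal I\subset\mathcal N,\ i\in\mathcal N .$$ Then the optimal classifier for $R$ is an $m$-most-probable classifier: for each $z\in\mathcal Z$ it is $\hat I(z)=\hat I_{m(z)}$, where $$m(z)=\operatorname*{arg\,max}_{0\le m\le N}\,[\,v(m;z)-g(m)\,],$$ with $v(0;z)=0$ and $v(m;z)=\sum_{j=1}^m p_{(N+1-j)}$ for $m=1,\ldots,N$.
   Context: Let $N\ge 1$ and $\mathcal N=\{1,\ldots,N\}$ be a finite set of categories. The true category $I$ is a random variable with prior $\pi_i=P(I=i)$, $i\in\mathcal N$. Conditionally on $I=i$, the observation $Z\in\mathcal Z$ has density (or probability function) $f_i$. The posterior probabilities given $Z=z$ are $p_i=p_i(z)=P(I=i\mid Z=z)=\pi_if_i(z)/\sum_{j=1}^N\pi_jf_j(z)$ (the denominator being positive). They are ordered as $p_{(1)}\le\cdots\le p_{(N)}$, and $(j)$ denotes the category whose posterior probability is $p_{(j)}$ (ties broken in some fixed way, so that $(1),\ldots,(N)$ is an enumeration of $\mathcal N$). A classifier assigns to each $z\in\mathcal Z$ a subset $\hat I(z)\subset\mathcal N$ (the empty set and all of $\mathcal N$ are allowed). A reward function $R(\mathcal I,i)$ is a real number for each $\mathcal I\subset\mathcal N$ and $i\in\mathcal N$. The value function is $V(z;\mathcal I)=E[R(\mathcal I,I)\mid Z=z]=\sum_{i=1}^N R(\mathcal I,i)\,p_i(z)$.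 The optimal (Bayes) classifier for $R$ is $\hat I(z)=\operatorname{arg\,max}_{\mathcal I\subset\mathcal N}V(z;\mathcal I)$ for each $z$. Here $\operatorname{arg\,max}$ means a point at which the maximum is attained (not necessarily unique). For $m\in\{0,\ldots,N\}$ the $m$-most-probable ($m$-MP) classifier is $\hat I_m=\{(N+1-m),\ldots,(N)\}$ if $m\ge1$ and $\hat I_0=\emptyset$. $1(\cdot)$ is the indicator function and $|\cdot|$ denotes cardinality. *)

(* Defs.v *)
From HB Require Import structures.
From mathcomp Require Export all_boot all_order all_algebra all_fingroup.
From mathcomp Require Export all_classical all_reals all_analysis.

Set Implicit Arguments.
Unset Strict Implicit.
Unset Printing Implicit Defensive.

Import Order.TTheory GRing.Theory Num.Theory.
Local Open Scope ring_scope.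

(* The categories 1, ..., N are the elements of 'I_N,
   shifted down by one. *)

Definition is_argmax (R : realType) (T : Type) (F : T -> R) (x : T) : Prop :=
  forall y, F y <= F x.

Definition prior (R : realType) (dO : measure_display)
    (Omega : measurableType dO) (P : probability Omega R) (N : nat)
    (I : Omega -> 'I_N) (i : 'I_N) : R :=
  fine (P [set w | I w = i]%classic).

(* P(I = i, Zobs \in B) = P(I = i) * \int_B f_i for all measurable B, where
   f_i is a probability density with respect to mu.  If mu is a counting
   measure, f_i is a probability function. *)
Record observation_model (R : realType) (dO dZ : measure_display)
    (Omega : measurableType dO) (Z : measurableType dZ)
    (P : probability Omega R) (mu : {measure set Z -> \bar R}) (N : nat)
    (I : Omega -> 'I_N) (Zobs : {RV P >-> Z}) (f : 'I_N -> Z -> R) : Prop :=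
  ObservationModel {
    category_measurable : forall i, measurable [set w | I w = i]%classic;
    density_measurable : forall i, measurable_fun setT (f i);
    density_ge0 : forall i z, 0 <= f i z;
    density_int1 : forall i, (\int[mu]_z (f i z)%:E = 1)%E;
    conditional_density : forall i (B : set Z), measurable B ->
      (P [set w | I w = i /\ B (Zobs w)]%classic =
       P [set w | I w = i]%classic * \int[mu]_(z in B) (f i z)%:E)%E
  }.

Section Classification.
Context (R : realType) (Z : Type) (N : nat).
Implicit Types (pi : 'I_N -> R) (f p : 'I_N -> Z -> R).

Definition posterior pi f (i : 'I_N) (z : Z) : R :=
  pi i * f i z / \sum_j pi j * f j z.

Definition value p (rew : {set 'I_N} -> 'I_N -> R) (z : Z)
    (A : {set 'I_N}) : R :=
  \sum_i rew A i * p i z.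

Definition optimal_classifier p rew (Ihat : Z -> {set 'I_N}) : Prop :=
  forall z, is_argmax (value p rew z) (Ihat z).

(* (j+1) = s z j, i.e. p_(j+1) is p (s z j) z; the
   permutation s z encodes the way in which ties are broken. *)
Definition posterior_order p (s : Z -> {perm 'I_N}) : Prop :=
  forall z (j k : 'I_N), (j <= k)%N -> p (s z j) z <= p (s z k) z.

(* {(N+1-m), ..., (N)}: 0-based ranks N-m, ..., N-1; empty for m = 0. *)
Definition most_probable (s : Z -> {perm 'I_N}) (m : nat) (z : Z) :
    {set 'I_N} :=
  [set s z j | j : 'I_N & (N - m <= j)%N]%SET.

(* Sum of p_(N+1-j) over 1 <= j <= m: with j shifted down by one, the rank
   N+1-j becomes rev_ord j. *)
Definition top_sum p (s : Z -> {perm 'I_N}) (m : nat) (z : Z) : R :=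
  \sum_(j < N | (j < m)%N) p (s z (rev_ord j)) z.

(* inord is harmless here: #|A| <= N. *)
Definition size_penalized_reward (g : 'I_N.+1 -> R) (A : {set 'I_N})
    (i : 'I_N) : R :=
  (i \in A)%:R - g (inord #|A|).

End Classification.

(* Main.v *)
Require Import Defs.
From mathcomp Require Import zify.

(** Posterior probabilities sum to 1, so the expected reward of a set [A] of
    categories is the posterior mass of [A] minus the penalty [g #|A|]
    ([value_size_penalized]).  The penalty depends on [A] only through its size;
    hence, among the sets of a given size [k], the best is the one of largest
    posterior mass, and this is the set of the [k] most probable categories
    ([sum_le_top_sum], from the rearrangement [sum_le_top_ranks]).  Its value is
    [top_sum p s k z - g k] ([value_most_probable]), which also bounds the value
    of every set of size [k] ([value_le_top_sum]).  Maximizing over all sets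
    therefore reduces to maximizing this expression over the finitely many
    sizes [k]. *)

Set Implicit Arguments.
Unset Strict Implicit.
Unset Printing Implicit Defensive.

Import Order.TTheory GRing.Theory Num.Theory.
Local Open Scope ring_scope.

Definition top_ranks (N k : nat) : {set 'I_N} :=
  [set j : 'I_N | (N - k <= j)%N]%SET.

Lemma top_ranks_rev N k :
  top_ranks N k = ([set rev_ord j | j : 'I_N & (j < k)%N])%SET.
Proof.
apply/setP => j; rewrite inE; apply/idP/imsetP => [Hj | [i Hi ->]].
  exists (rev_ord j); last by rewrite rev_ordK.
  by rewrite inE /=; have := ltn_ord j; lia.
by move: Hi; rewrite inE /=; have := ltn_ord i; lia.
Qed.

Lemma card_top_ranks N k : (k <= N)%N -> #|top_ranks N k| = k.
Proof.
move=> kN; rewrite top_ranks_rev card_imset; last exact: rev_ord_inj.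
rewrite -sum1_card; under eq_bigl do rewrite inE.
by rewrite -(big_ord_widen N (fun=> 1%N)) // sum1_card card_ord.
Qed.

(** Shift [a] by its value [c] at the lowest rank of the top set: [a - c] is
    nonnegative on the top set and nonpositive off it, so the top set has the
    largest sum of [a - c] among all sets.  Both sets having the same size, the
    shift changes the two sums equally. *)
Lemma sum_le_top_ranks (R : numDomainType) (N : nat) (a : 'I_N -> R)
    (J : {set 'I_N}) :
  {homo a : i j / (i <= j)%N >-> i <= j} ->
  \sum_(j in J) a j <= \sum_(j in top_ranks N #|J|) a j.
Proof.
move=> a_mono.
have JN : (#|J| <= N)%N by rewrite -[leqRHS]card_ord max_card.
have [J0 | J_gt0] := posnP #|J|.
  rewrite (cards0_eq J0) cards0 big_set0 big_pred0 // => j.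
  by rewrite inE subn0 leqNgt ltn_ord.
have rN : (N - #|J| < N)%N by lia.
pose c := a (Ordinal rN).
have shift_top : \sum_(j in top_ranks N #|J|) c = \sum_(j in J) c.
  by rewrite !sumr_const card_top_ranks.
rewrite -(lerD2r (- \sum_(j in J) c)) -[in leRHS]shift_top -!sumrB.
rewrite big_mkcond [leRHS]big_mkcond; apply: ler_sum => j _.
rewrite [j \in top_ranks _ _]inE; case: leqP => [c_le_j | j_lt_c].
  by case: ifP => // _; rewrite subr_ge0 a_mono.
by case: ifP => // _; rewrite subr_le0 a_mono //= ltnW.
Qed.

Section Classifier.
Context (R : realType) (Z : Type) (N : nat).
Implicit Types (p : 'I_N -> Z -> R) (s : Z -> {perm 'I_N}).

Lemma sum_posterior (pi : 'I_N -> R) (f : 'I_N -> Z -> R) z :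
  0 < \sum_j pi j * f j z -> \sum_i posterior pi f i z = 1.
Proof. by move=> D_gt0; rewrite -mulr_suml divff ?gt_eqF. Qed.

Lemma most_probableE s k z : most_probable s k z = (s z @: top_ranks N k)%SET.
Proof. by []. Qed.

Lemma card_most_probable s k z : (k <= N)%N -> #|most_probable s k z| = k.
Proof.
by move=> kN; rewrite most_probableE card_imset ?card_top_ranks//; exact: perm_inj.
Qed.

Lemma top_sumE p s k z :
  top_sum p s k z = \sum_(j in top_ranks N k) p (s z j) z.
Proof.
rewrite top_ranks_rev big_imset /=; last by move=> i j _ _; exact: rev_ord_inj.
by apply: eq_bigl => j; rewrite inE.
Qed.

(** Through the enumeration [s z], a set of categories becomes a set of ranks
    of the same size, and the posterior becomes nondecreasing in the rank. *)
Lemma sum_le_top_sum p s (A : {set 'I_N}) z : posterior_order p s ->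
  \sum_(i in A) p i z <= top_sum p s #|A| z.
Proof.
move=> p_sorted.
have sJ : A = (s z @: (s z @^-1: A))%SET.
  apply/setP => i; rewrite -[i in LHS](permKV (s z)) -[i in RHS](permKV (s z)).
  by rewrite mem_imset ?inE //; exact: perm_inj.
rewrite top_sumE [in leLHS]sJ [in leRHS]sJ big_imset /=; last first.
  by move=> i j _ _; exact: perm_inj.
rewrite card_imset; last exact: perm_inj.
by apply: (sum_le_top_ranks (a := fun j => p (s z j) z)) => i j; exact: p_sorted.
Qed.

Variables (p : 'I_N -> Z -> R) (g : 'I_N.+1 -> R) (z : Z).
Hypothesis p_sum1 : \sum_i p i z = 1.

Lemma value_size_penalized (A : {set 'I_N}) :
  value p (size_penalized_reward g) z A = \sum_(i in A) p i z - g (inord #|A|).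
Proof.
rewrite /value /size_penalized_reward; under eq_bigr do rewrite mulrBl.
rewrite sumrB -mulr_sumr p_sum1 mulr1; congr (_ - _).
rewrite [RHS]big_mkcond; apply: eq_bigr => i _.
by case: (i \in A); rewrite ?mul1r ?mul0r.
Qed.

Lemma value_most_probable s (k : 'I_N.+1) :
  value p (size_penalized_reward g) z (most_probable s k z) =
  top_sum p s k z - g k.
Proof.
have kN : (k <= N)%N by rewrite -ltnS.
rewrite value_size_penalized card_most_probable // inord_val top_sumE.
by rewrite most_probableE big_imset //= => i j _ _; exact: perm_inj.
Qed.

Lemma value_le_top_sum s (A : {set 'I_N}) : posterior_order p s ->
  value p (size_penalized_reward g) z A <=
  top_sum p s #|A| z - g (inord #|A|).
Proof. by move=> ps; rewrite value_size_penalized lerD2r sum_le_top_sum. Qed.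

End Classifier.

Theorem proposition1 (R : realType) (N : nat) (hN : (1 <= N)%N)
    (dO dZ : measure_display)
    (Omega : measurableType dO) (Z : measurableType dZ)
    (P : probability Omega R) (mu : {measure set Z -> \bar R})
    (I : Omega -> 'I_N) (Zobs : {RV P >-> Z}) (f : 'I_N -> Z -> R)
    (hmodel : observation_model mu I Zobs f)
    (hpos : forall z, 0 < \sum_j prior P I j * f j z)
    (s : Z -> {perm 'I_N})
    (hs : posterior_order (posterior (prior P I) f) s)
    (g : 'I_N.+1 -> R) (hg : forall m, 0 <= g m) :
  let p := posterior (prior P I) f in
  let is_optimal_size (m : Z -> 'I_N.+1) :=
    forall z, is_argmax (fun k : 'I_N.+1 => top_sum p s k z - g k) (m z) in
  (exists m, is_optimal_size m) /\
  (forall m, is_optimal_size m ->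
    optimal_classifier p (size_penalized_reward g)
      (fun z => most_probable s (m z) z)).
Proof.
move=> p is_optimal_size; split.
  exists (fun z => [arg max_(k > ord0 : 'I_N.+1) (top_sum p s k z - g k)]%O).
  by move=> z k; case: arg_maxP => // m _; exact.
move=> m m_opt z A.
have p_sum1 : \sum_i p i z = 1 by exact: sum_posterior.
rewrite value_most_probable //; apply: le_trans (value_le_top_sum g p_sum1 A hs) _.
have AN : (#|A| < N.+1)%N by rewrite ltnS -[leqRHS]card_ord max_card.
by have := m_opt z (inord #|A|); rewrite /= inordK.
Qed.
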